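(* Let $\mathcal{U}$ be an ultrafilter over $\omega$. Then $\mathcal{U}$ is a Laver ultrafilter if and only if $\mathcal{U}$ is an $\mathcal{I}_f$-ultrafilter for each $f\in\mathcal{H}$.
   Context: By an ultrafilter we always mean a non-principal ultrafilter. Laver ultrafilter: an ultrafilter $\mathcal{U}$ over $\omega$ is a Laver ultrafilter if for every sequence $\langle \mathcal{P}_n : n\in\omega\rangle$, where each $\mathcal{P}_n$ is a partition of $\omega$ into finitely many sets, there exists $x\in\mathcal{U}$ such that for all $n\in\omega$, $x$ has non-empty intersection with at most $n+1$ elements of $\mathcal{P}_n$. For $A\subseteq 2^\omega$ and $n\in\omega$, $\mathrm{level}_A(n):=|\{h|_n : h\in A\}|$. $\mathcal{H}:=\{f\in\omega^\omega : f \text{ is non-decreasing, unbounded and } \forall n\in\omega:\ f(n)\le n\}$. For $f\in\mathcal{H}$, $\mathcal{I}_f:=\{A\subseteq 2^\omega : \forall d>0:\ \mathrm{level}_A\le^{\ast}\tfrac{1}{d}f\}$, an ideal on $2^\omega$, where $g\le^{\ast}h$ means $g(n)\le h(n)$ for all but finitely many $n$. For a collection $\mathcal{I}$ of subsets of a set $X$, closed under subsets and containing all singletons, an ultrafilter $\mathcal{U}$ over $\omega$ is an $\mathcal{I}$-ultrafilter if for every $F:\omega\to X$ there is $x\in\mathcal{U}$ with $F[x]\in\mathcal{I}$. Here $X=2^\omega$. *)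

(* Defs.v *)
From mathcomp Require Import all_boot all_order all_algebra finmap.
From mathcomp Require Import boolp classical_sets functions cardinality filter.
From mathcomp Require Import reals topology.

Set Implicit Arguments.
Unset Strict Implicit.
Unset Printing Implicit Defensive.

Import Order.TTheory GRing.Theory Num.Theory.

Local Open Scope classical_set_scope.
Local Open Scope ring_scope.

(* "Ultrafilter over omega" always means a non-principal one. *)
Definition nonprincipal_ultrafilter (U : set_system nat) : Prop :=
  UltraFilter U /\ forall n : nat, U <> principal_filter n.

(* A partition is a set of blocks, which the library's [partition] takes as
   the identity family indexed by the blocks themselves; blocks are nonempty. *)
Definition finite_partition (P : set (set nat)) : Prop :=
  finite_set P /\ partition P id setT.

Definition laver_ultrafilter (U : set_system nat) : Prop :=
  nonprincipal_ultrafilter U /\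
  forall P : nat -> set (set nat), (forall n, finite_partition (P n)) ->
    exists2 x : set nat, U x &
      forall n, ([set B | P n B /\ x `&` B !=set0] #<= `I_n.+1)%card.

(* The Cantor space 2^omega is [nat -> bool], and h|_n is the function that
   h induces on {0, ..., n-1}. *)
Definition restr (n : nat) (h : nat -> bool) : {ffun 'I_n -> bool} :=
  [ffun i : 'I_n => h i].

Definition level (A : set (nat -> bool)) (n : nat) : nat :=
  #|` fset_set (restr n @` A)|.

Definition calH : set (nat -> nat) :=
  [set f | [/\ {homo f : m n / (m <= n)%N},
               forall m, exists n, (m < f n)%N
             & forall n, (f n <= n)%N]].

Definition ideal_of (R : realType) (f : nat -> nat) : set (set (nat -> bool)) :=
  [set A | forall d : R, 0 < d ->
     \forall n \near \oo, (level A n)%:R <= d^-1 * (f n)%:R].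

Definition I_ultrafilter (X : Type) (I : set (set X)) (U : set_system nat) :
    Prop :=
  nonprincipal_ultrafilter U /\
  forall F : nat -> X, exists2 x : set nat, U x & I (F @` x).

(* The next two facts are the standing requirements on the collection I in
   the notion of I-ultrafilter. *)
Lemma ideal_of_subset (R : realType) (f : nat -> nat) (A B : set (nat -> bool)) :
  A `<=` B -> ideal_of R f B -> ideal_of R f A.
Proof.
move=> AB IB d d0; have := IB d d0; apply: filterS => n; apply: le_trans.
rewrite ler_nat; apply: fsubset_leq_card.
have fin (C : set {ffun 'I_n -> bool}) : finite_set C.
  exact: finite_finset.
by rewrite -fset_set_sub//; exact: image_subset.
Qed.

Lemma ideal_of_set1 (R : realType) (f : nat -> nat) (h : nat -> bool) :
  calH f -> ideal_of R f [set h].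
Proof.
move=> [fmono funb _] d d0; have [N Nf] := funb (Num.truncn d).
exists N => // n /= Nn; rewrite /level image_set1 fset_set1 cardfs1.
rewrite mulrC ler_pdivlMr// mul1r.
have /andP[_ /ltW dlt] := truncn_itv (ltW d0).
apply: (le_trans dlt); rewrite ler_nat.
exact: leq_trans Nf (fmono _ _ Nn).
Qed.

(* Main.v *)
Require Import Defs.
From mathcomp Require Import all_boot all_order all_algebra finmap.
From mathcomp Require Import boolp classical_sets functions cardinality filter.
From mathcomp Require Import reals topology.

Import Order.TTheory GRing.Theory Num.Theory.

Local Open Scope classical_set_scope.

(** A map F from omega to the Cantor space, together with cut points m 0,
    m 1, ..., induces a sequence of finite partitions of omega: the k-th one
    groups the indices i according to the restriction of F i to the first m k
    bits. A set x meets exactly as many of its blocks as the level of F @` x at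
    m k, and at most as many blocks of any coarser partition
    ([card_fibers_meeting], [card_blocks_meeting]). Conversely every sequence of
    finite partitions is coarser than one of this form. So both sides of the
    equivalence bound the same kind of numbers, and the freedom in the cut
    points reconciles the two rates of growth.

    From Laver to I_f: f is unbounded, so the cut points can be taken with
    f (m k) at least (k+2)^2. A Laver set x for the resulting partitions gives
    levels of at most k+1 at m k. Levels and f are both monotone, hence between
    m k and m (k+1) the level is at most k+2 while f is at least (k+2)^2, and
    the quotient tends to infinity ([ideal_of_level_bound]).

    From I_f to Laver: the memberships of i in all the blocks of all the
    partitions are countably many bits, which make up F i; those concerning
    the n-th partition lie below some m n ([block_coding]). Some f in H grows so
    slowly that f (m n) <= n for all n ([slow_inverse]). A set x with
    F @` x in I_f, used only with d = 1, then meets at most n blocks of the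
    n-th partition for all large n. The finitely many remaining n are repaired
    by intersecting x with one block in U of each of those partitions
    ([laver_of_eventually]); such blocks exist because U is an ultrafilter
    ([ultra_block]). *)

(** * Levels *)

Section Level.
Implicit Types (A : set (nat -> bool)) (n : nat).

Lemma card_level A n : (restr n @` A #= `I_(level A n))%card.
Proof.
have /finite_setP[m Am] : finite_set (restr n @` A) by exact: finite_finset.
by rewrite /level (card_fset_set Am).
Qed.

Lemma level_homo A m n : (m <= n)%N -> (level A m <= level A n)%N.
Proof.
move=> mn; apply: geq_card_fset_set.
pose phi (s : {ffun 'I_n -> bool}) := [ffun i : 'I_m => s (widen_ord mn i)].
have -> : restr m @` A = phi @` (restr n @` A).
  rewrite image_comp; apply: eq_imagel => h _.
  by apply/ffunP => i; rewrite !ffunE.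
by rewrite -(card_le_eqr (card_level A n)); exact: card_image_le.
Qed.

Lemma eq_restr_at n h h' i : (i < n)%N -> restr n h = restr n h' -> h i = h' i.
Proof. by move=> lt_in /ffunP/(_ (Ordinal lt_in)); rewrite !ffunE. Qed.

End Level.

(** * Blocks of a partition met by a set *)

Section Blocks.
Context {T : pointedType} {T' : Type}.
Implicit Types (g : T -> T') (x : set T) (P : set (set T)).

Definition fibers g : set (set T) := [set g @^-1` [set g i] | i in setT].

(** Distinct values of g on x have distinct fibers, and each of them meets x. *)
Lemma card_fibers_meeting g x :
  (g @` x #<= [set B | fibers g B /\ x `&` B !=set0])%card.
Proof.
pose phi (t : T') := g @^-1` [set t].
have inj : {in g @` x &, injective phi}.
  move=> t u /set_mem[i xi <-] _ e.
  by have : phi (g i) i by []; rewrite e.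
rewrite -(card_le_eql (inj_card_eq inj)).
by apply: subset_card_le => _ [_ [i xi <-] <-]; split; [exists i|exists i].
Qed.

(** If g separates the blocks of P, then picking a point of x in each block
    that x meets and applying g to it is injective on those blocks. *)
Lemma card_blocks_meeting P g x : trivIset P id ->
  (forall B i j, P B -> g i = g j -> B i -> B j) ->
  ([set B | P B /\ x `&` B !=set0] #<= g @` x)%card.
Proof.
move=> triv sep; set D := [set B | _].
pose rep (B : set T) := xget point (x `&` B).
have repP B : D B -> x (rep B) /\ B (rep B).
  by move=> [_ ne]; exact: (xgetPex point ne).
have inj : {in D &, injective (g \o rep)}.
  move=> B C /set_mem DB /set_mem DC /= e.
  apply: triv; [exact: DB.1|exact: DC.1|].
  exists (rep C); split; last by have [] := repP _ DC.
  by apply: sep e _; [exact: DB.1|have [] := repP _ DB].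
rewrite -(card_le_eql (inj_card_eq inj)).
by apply: subset_card_le => _ [B /repP[xB _] <-]; exists (rep B).
Qed.

End Blocks.

Lemma fibers_partition (T : finType) (g : nat -> T) : finite_partition (fibers g).
Proof.
split.
  have -> : fibers g = (fun t => g @^-1` [set t]) @` range g by rewrite image_comp.
  by apply: finite_image; exact: finite_finset.
split.
- by rewrite -subTset => i _; exists (g @^-1` [set g i]) => //; exists i.
- move=> _ _ [i _ <-] [j _ <-] [k [/= ki kj]].
  by rewrite -ki -kj.
- by move=> _ [i _ <-]; exists i.
Qed.

(** * Blocks and ultrafilters *)

(** Otherwise the complements of the finitely many blocks would all be in U,
    and so would their intersection, which is empty. *)
Lemma ultra_block (U : set_system nat) (P : set (set nat)) :
  UltraFilter U -> finite_partition P -> exists2 B, P B & U B.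
Proof.
move=> UU [finP [covP _ _]]; apply: contrapT => noB.
suff : U set0 by exact: filter_not_empty.
have : U (\bigcap_(B in [set` fset_set P]) ~` B).
  apply: filter_bigI => B; rewrite in_fset_set// => /set_mem PB.
  by have [UB|//] := in_ultra_setVsetC B UU; case: noB; exists B.
apply: filterS => i iP; have : setT i by [].
rewrite -covP => -[B PB Bi].
by apply: (iP B) => //=; rewrite in_fset_set//; exact: mem_set.
Qed.

(** For n < N, intersecting x with a single block of P n leaves only that
    block to be met, and U contains such a block; shrinking x does not spoil
    the bound at the other n. *)
Lemma laver_of_eventually (U : set_system nat) (P : nat -> set (set nat)) x N :
  UltraFilter U -> (forall n, finite_partition (P n)) -> U x ->
  (forall n, (N <= n)%N ->
     ([set B | P n B /\ x `&` B !=set0] #<= `I_n.+1)%card) ->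
  exists2 y, U y &
    forall n, ([set B | P n B /\ y `&` B !=set0] #<= `I_n.+1)%card.
Proof.
move=> UU finP Ux xN.
have /choice[b bP] : forall n, exists B, P n B /\ U B.
  by move=> n; have [B] := ultra_block U (P n) UU (finP n); exists B.
exists (x `&` \bigcap_(n in [set` [fset val i | i in 'I_N]%fset]) b n).
  by apply: filterI => //; apply: filter_bigI => n _; exact: (bP n).2.
move=> n; have [/xN|ltnN] := leqP N n.
  apply: card_le_trans; apply: subset_card_le => B [PB [i [[xi _] Bi]]].
  by split=> //; exists i.
apply: (@card_le_trans _ _ _ [set b n]); last first.
  by rewrite (card_le_eql card_set1) card_le_II.
apply: subset_card_le => B [PB [i [[_ bi] Bi]]] /=.
have [_ [_ triv _]] := finP n.
apply: triv => //; first exact: (bP n).1.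
exists i; split=> //; apply: bi => /=.
by apply/imfsetP; exists (Ordinal ltnN).
Qed.

(** * Growth rates *)

(** The square makes f outgrow the level by a factor k+2 on the whole interval
    from m k to m (k+1), which beats any prescribed constant d. *)
Lemma ideal_of_level_bound (R : realType) f A (m : nat -> nat) :
  calH f -> (forall k, (k.+2 ^ 2 <= f (m k))%N) ->
  (forall k, (level A (m k) <= k.+1)%N) -> ideal_of R f A.
Proof.
move=> [fmono _ fle] fm Am d d0.
pose D := Num.truncn d; exists (m D) => // n /= mDn.
(* since f (m k) <= m k, the cut points tend to infinity, so there is a
   last cut point m k below n *)
have m_ge k : (k <= m k)%N.
  apply: leq_trans (fle _); apply: leq_trans (fm k).
  by rewrite (leq_trans (leqW (leqnSn k)))// expnS leq_pmulr// expn_gt0.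
have ex : exists k, (m k <= n)%N by exists D.
have ub k : (m k <= n)%N -> (k <= n)%N by exact: leq_trans (m_ge k).
have [k mkn kmax] := ex_maxnP ex ub.
have Dk : (D <= k)%N by exact: kmax.
have lek : (level A n <= k.+2)%N.
  apply: leq_trans (Am k.+1); apply: level_homo; rewrite leqNgt.
  by apply/negP => /ltnW/kmax; rewrite ltnn.
rewrite mulrC ler_pdivlMr//.
have /andP[_ /ltW dD] := truncn_itv (ltW d0).
apply: (@le_trans _ _ ((level A n)%:R * D.+1%:R)%R); first exact: ler_wpM2l.
rewrite -natrM ler_nat; apply: leq_trans (fmono _ _ mkn).
by apply: leq_trans (fm k); rewrite expnS expn1 leq_mul// ltnS (leq_trans Dk).
Qed.

(** The witness is f x = min {n | x <= m n}, a generalized inverse of m. It is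
    unbounded because f x <= k forces x below the maximum of m 0, ..., m k. *)
Lemma slow_inverse (m : nat -> nat) : (forall n, (n <= m n)%N) ->
  exists2 f, calH f & forall n, (f (m n) <= n)%N.
Proof.
move=> m_ge; pose ex x := ex_intro (fun n => x <= m n)%N x (m_ge x).
exists (fun x => ex_minn (ex x)); last first.
  by move=> n; case: ex_minnP => k _; apply.
split.
- move=> x y xy /=; case: ex_minnP => i _ imin; case: ex_minnP => j yj _.
  by apply: imin; exact: leq_trans yj.
- move=> k; exists (\max_(i < k.+1) m i).+1.
  case: ex_minnP => j; rewrite ltnNge => jP _.
  rewrite ltnNge; apply: contra jP => jk.
  exact: (leq_bigmax (Ordinal (jk : (j < k.+1)%N))).
- by move=> x; case: ex_minnP => i _; apply.
Qed.

(** * Coding partitions by points of the Cantor space *)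

(** The bit of F i with index pickle (n, j) records whether i lies in the j-th
    block of P n. As P n has finitely many blocks, its bits lie in an initial
    segment; the maximum with n makes m unbounded. *)
Lemma block_coding (P : nat -> set (set nat)) : (forall n, finite_set (P n)) ->
  exists (F : nat -> nat -> bool) (m : nat -> nat),
    (forall n, (n <= m n)%N) /\
    forall n B i j, P n B -> restr (m n) (F i) = restr (m n) (F j) -> B i -> B j.
Proof.
move=> finP; pose s n : seq (set nat) := fset_set (P n).
pose bit i (c : nat * nat) := `[< nth set0 (s c.1) c.2 i >].
exists (fun i p => oapp (bit i) false (choice.unpickle p)).
exists (fun n => maxn n (\max_(j < size (s n)) (choice.pickle (n, val j)).+1)).
split=> [n|n B i j PB]; first exact: leq_maxl.
have Bs : B \in s n by rewrite in_fset_set//; exact: mem_set.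
have lt_idx : (index B (s n) < size (s n))%N by rewrite index_mem.
pose k := Ordinal lt_idx.
have lt_pk : (choice.pickle (n, val k) <
    maxn n (\max_(j < size (s n)) (choice.pickle (n, val j)).+1))%N.
  by apply: leq_trans (leq_maxr _ _); exact: (leq_bigmax k).
move=> /(eq_restr_at _ _ _ _ lt_pk); rewrite choice.pickleK /bit /= nth_index//.
by move=> e /asboolP; rewrite e => /asboolP.
Qed.

Theorem proposition2p6 (R : realType) (U : set_system nat)
    (hU : nonprincipal_ultrafilter U) :
  laver_ultrafilter U <->
  (forall f : nat -> nat, calH f -> I_ultrafilter (ideal_of R f) U).
Proof.
split=> [[_ laverU] f Hf|idealU]; split=> //.
- move=> F; have [fmono funb _] := Hf.
  have /choice[m mP] : forall k, exists n, (k.+2 ^ 2 <= f n)%N.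
    by move=> k; have [n /ltnW] := funb (k.+2 ^ 2)%N; exists n.
  have [x Ux xP] := laverU _ (fun k => fibers_partition _ (restr (m k) \o F)).
  exists x => //; apply: (ideal_of_level_bound R _ _ m Hf mP) => k.
  rewrite -card_le_II -(card_le_eql (card_level _ _)) image_comp.
  exact: card_le_trans (card_fibers_meeting _ _) (xP k).
- move=> P finP.
  have [F [m [m_ge sepF]]] := block_coding P (fun n => (finP n).1).
  have [f Hf fm] := slow_inverse m m_ge.
  have [_ /(_ F)[x Ux /(_ 1%R ltr01)[N _ xN]]] := idealU f Hf.
  apply: (laver_of_eventually U P x N) => //; first exact: hU.1.
  move=> n Nn; have [_ [_ triv _]] := finP n.
  apply: card_le_trans (card_blocks_meeting _ (restr (m n) \o F) x triv _) _.
    by move=> B i j PB; exact: sepF.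
  rewrite -image_comp (card_le_eql (card_level _ _)) card_le_II.
  apply: leqW; apply: leq_trans (fm n).
  have := xN (m n) (leq_trans Nn (m_ge n)).
  by rewrite invr1 mul1r ler_nat.
Qed.
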